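(* Let $S$ be a (possibly infinite) bounded non-empty set of (possibly complex) numbers and let $P(z) = \sum_{j=0}^\infty p_j z^j$ be a power series with coefficients in $S$ and with $p_0 = 1$. Then for any roots $\lambda_1, \ldots, \lambda_k \in \mathbb{D}$ of $P(z)$ (listed according to multiplicity, i.e. each root occurs in the list at most as many times as its multiplicity), we have $$\prod_{j=1}^k (|\lambda_j|^{-1} - 1) \leqslant \sup_j |p_j|.$$ In particular, $P(z)$ does not have $k$ roots $\lambda_1, \ldots, \lambda_k \in \mathbb{D}$ (listed according to multiplicity) all satisfying $|\lambda_j| < \frac{1}{(\sup_i |p_i|)^{1/k} + 1}$.
   Context: $\mathbb{D}$ is the open unit disc in $\mathbb{C}$; since the coefficients are bounded, $P$ is holomorphic on $\mathbb{D}$. *)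

(* Defs.v *)
From Stdlib Require Import Reals List.
From Coquelicot Require Import Coquelicot.

Local Open Scope C_scope.

(* [iota] selects the sum of the series where it converges. *)
Definition CPSeries (a : nat -> C) (z : C) : C :=
  iota (T := CompleteNormedModule.CompleteSpace _ C_CompleteNormedModule)
    (fun l : C => is_pseries a z l).

(* The value [real] is the true supremum only when the coefficients are bounded
   ([real] sends an infinite supremum to 0). *)
Definition sup_coeff (a : nat -> C) : R :=
  real (Sup_seq (fun j => Finite (Cmod (a j)))).

(* [m] is the order of vanishing of [f] at [z] (0 when [f z <> 0]); it is unique
   when it exists, and exists unless [f] vanishes identically near [z]
   ([f] holomorphic near [z]). *)
Definition has_multiplicity (f : C -> C) (z : C) (m : nat) : Prop :=
  exists g : C -> C,
    g z <> 0 /\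
    locally z (fun w => ex_derive g w) /\
    locally z (fun w => f w = (w - z) ^ m * g w).

Definition disc_roots_with_multiplicity (f : C -> C) (ls : list C) : Prop :=
  forall z : C, In z ls ->
    (Cmod z < 1)%R /\ f z = 0 /\
    exists m : nat, has_multiplicity f z m /\ (count_occ Ceq_dec ls z <= m)%nat.

Definition prod_list (rs : list R) : R := fold_right Rmult 1%R rs.

(* Main.v *)
Require Import Defs.
From Stdlib Require Import Reals List Lra Lia FunctionalExtensionality.
From Coquelicot Require Import Coquelicot.

(** Dividing [P(z) = sum_j p_j z^j] by [z - c], where [c] is a root in the open
    unit disc, gives the power series [Q] with coefficients
    [q_n = sum_i p_(n+1+i) c^i].  Two things happen to the data: the constant
    terms satisfy [p_0 = - c q_0], and the geometric series shows that a bound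
    [M] on the [|p_n|] becomes the bound [M / (1 - |c|)] on the [|q_n|].  After
    all the roots have been divided out, the last quotient has a constant term
    of modulus [|p_0| / prod |c_j|], which cannot exceed the bound
    [M / prod (1 - |c_j|)] on its coefficients.  With [p_0 = 1] this is
    [prod (1 / |c_j| - 1) <= M], and [M] is taken to be the supremum of the
    [|p_n|].  The induction over the roots is [constant_term_prod_roots_le].

    The induction needs the remaining roots, with their multiplicities, to be
    roots of [Q].  The order of vanishing is therefore recorded as a growth
    bound [|f w| <= K |w - z|^n] on a punctured neighbourhood of [z]: this form
    passes to the quotient by elementary estimates, without any theory of
    holomorphic functions ([vanishes_to_order_quotient]).

    The second part follows because [|c_j| < 1 / (M^(1/k) + 1)] says exactly
    that [1 / |c_j| - 1 > M^(1/k)], and the product of [k] such numbers would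
    exceed [M]. *)

Local Open Scope C_scope.

Definition coeff_bound (a : nat -> C) (M : R) : Prop :=
  forall n, (Cmod (a n) <= M)%R.

Definition shift (a : nat -> C) : nat -> C := fun n => a (S n).

(** The coefficients of [(P(w) - P(c)) / (w - c)], see [CPSeries_quotient]. *)
Definition quotient_coeff (a : nat -> C) (c : C) : nat -> C :=
  fun n => CPSeries (fun i => a (S n + i)%nat) c.

(** The punctured neighbourhood leaves [f z] free, so that dividing [f] by a
    linear factor vanishing at [z] raises no question about the value there. *)
Definition vanishes_to_order (f : C -> C) (z : C) (n : nat) : Prop :=
  exists K d : R, (0 < d)%R /\
    forall w, (0 < Cmod (w - z) < d)%R -> (Cmod (f w) <= K * Cmod (w - z) ^ n)%R.

(** * Power series with bounded coefficients *)

Lemma coeff_bound_nonneg a M : coeff_bound a M -> (0 <= M)%R.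
Proof. intros H. specialize (H 0%nat). generalize (Cmod_ge_0 (a 0%nat)). lra. Qed.

Lemma is_pseries_C_unique (a : nat -> C) (z l : C) :
  is_pseries (V := C_NormedModule) a z l -> CPSeries a z = l.
Proof.
  intros H. unfold CPSeries.
  apply (iota_unique (V := C_CompleteNormedModule)); [ | exact H].
  intros y Hy.
  exact (filterlim_locally_unique (V := C_NormedModule) _ _ _ Hy H).
Qed.

Lemma norm_pseries_term_le a M z n :
  coeff_bound a M ->
  (norm (scal (V := C_NormedModule) (pow_n (K := C_AbsRing) z n) (a n))
   <= M * Cmod z ^ n)%R.
Proof.
  intros Ha. change (Cmod (z ^ n * a n) <= M * Cmod z ^ n)%R.
  rewrite Cmod_mult, Cmod_pow, Rmult_comm.
  apply Rmult_le_compat_r; [apply pow_le, Cmod_ge_0 | apply Ha].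
Qed.

Lemma is_series_geom_scal M r :
  (0 <= r < 1)%R -> is_series (fun n => M * r ^ n)%R (M / (1 - r))%R.
Proof.
  intros Hr. apply (is_series_scal (K := R_AbsRing) (V := R_NormedModule) M).
  apply is_series_geom. rewrite Rabs_pos_eq; lra.
Qed.

Lemma CPSeries_correct a M z :
  coeff_bound a M -> (Cmod z < 1)%R ->
  is_pseries (V := C_NormedModule) a z (CPSeries a z).
Proof.
  intros Ha Hz.
  destruct (ex_series_le (V := C_CompleteNormedModule)
    (fun n => scal (V := C_NormedModule) (pow_n (K := C_AbsRing) z n) (a n))
    (fun n => M * Cmod z ^ n)%R) as [l Hl].
  - intros n. apply norm_pseries_term_le, Ha.
  - exists (M / (1 - Cmod z))%R. apply is_series_geom_scal.
    split; [apply Cmod_ge_0 | exact Hz].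
  - assert (H : is_pseries (V := C_NormedModule) a z l) by exact Hl.
    now rewrite (is_pseries_C_unique a z l H).
Qed.

Lemma Cmod_CPSeries_le a M z :
  coeff_bound a M -> (Cmod z < 1)%R ->
  (Cmod (CPSeries a z) <= M / (1 - Cmod z))%R.
Proof.
  intros Ha Hz.
  assert (Hlim : filterlim (fun n => norm (sum_n (fun n =>
      scal (V := C_NormedModule) (pow_n (K := C_AbsRing) z n) (a n)) n))
      eventually (locally (norm (V := C_NormedModule) (CPSeries a z)))).
  { eapply filterlim_comp; [exact (CPSeries_correct a M z Ha Hz) | ].
    apply filterlim_norm. }
  assert (Hgeom := is_series_geom_scal M (Cmod z) (conj (Cmod_ge_0 z) Hz)).
  refine (is_lim_seq_le _ _ (Finite _) (Finite _) _ Hlim Hgeom).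
  intros n. unfold sum_n.
  eapply Rle_trans; [apply (norm_sum_n_m (V := C_NormedModule)) | ].
  apply sum_n_m_le. intros k. apply norm_pseries_term_le, Ha.
Qed.

Lemma CPSeries_rec a M z :
  coeff_bound a M -> (Cmod z < 1)%R ->
  CPSeries a z = a 0%nat + z * CPSeries (shift a) z.
Proof.
  intros Ha Hz. apply is_pseries_C_unique.
  assert (H : is_pseries (V := C_NormedModule) (shift a) z (CPSeries (shift a) z)).
  { apply CPSeries_correct with M; [intros n; apply Ha | exact Hz]. }
  apply (is_series_scal (V := C_NormedModule) z) in H.
  apply (is_series_decr_1 (V := C_NormedModule)).
  match goal with |- is_series _ ?l =>
    replace l with (scal (V := C_NormedModule) z (CPSeries (shift a) z)) end.
  - eapply is_series_ext; [ | exact H].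
    intros n. unfold shift. rewrite scal_assoc. reflexivity.
  - change (z * CPSeries (shift a) z =
      a 0%nat + z * CPSeries (shift a) z + - (RtoC 1 * a 0%nat)). ring.
Qed.

Lemma CPSeries_minus_scal a b Ma Mb c z :
  coeff_bound a Ma -> coeff_bound b Mb -> (Cmod z < 1)%R ->
  CPSeries (fun n => a n - c * b n) z = CPSeries a z - c * CPSeries b z.
Proof.
  intros Ha Hb Hz. apply is_pseries_C_unique.
  apply (is_pseries_minus (V := C_NormedModule) a (PS_scal (V := C_NormedModule) c b)).
  - now apply CPSeries_correct with Ma.
  - apply (is_pseries_scal (V := C_NormedModule)).
    + apply Cmult_comm.
    + now apply CPSeries_correct with Mb.
Qed.

(** * Division by a linear factor *)

Lemma quotient_coeff_bound a M c :
  coeff_bound a M -> (Cmod c < 1)%R ->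
  coeff_bound (quotient_coeff a c) (M / (1 - Cmod c)).
Proof.
  intros Ha Hc n. apply Cmod_CPSeries_le; [intros i; apply Ha | exact Hc].
Qed.

Lemma CPSeries_quotient_0 a M c :
  coeff_bound a M -> (Cmod c < 1)%R ->
  CPSeries a c = a 0%nat + c * quotient_coeff a c 0.
Proof. exact (CPSeries_rec a M c). Qed.

Lemma quotient_coeff_rec a M c n :
  coeff_bound a M -> (Cmod c < 1)%R ->
  quotient_coeff a c n = a (S n) + c * quotient_coeff a c (S n).
Proof.
  intros Ha Hc. unfold quotient_coeff at 1.
  rewrite (CPSeries_rec _ M) by (assumption || (intros i; apply Ha)).
  rewrite Nat.add_0_r.
  assert (E : shift (fun i => a (S n + i)%nat) = fun i => a (S (S n) + i)%nat).
  { apply functional_extensionality. intros i. unfold shift.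
    f_equal. lia. }
  now rewrite E.
Qed.

(** From [q_n = p_(n+1) + c q_(n+1)], the coefficients of [P], without the
    constant one, are those of [Q(w) - c (Q(w) - q_0) / w]. *)
Lemma CPSeries_quotient a M c w :
  coeff_bound a M -> (Cmod c < 1)%R -> (Cmod w < 1)%R ->
  CPSeries a w - CPSeries a c = (w - c) * CPSeries (quotient_coeff a c) w.
Proof.
  intros Ha Hc Hw.
  assert (Hq := quotient_coeff_bound a M c Ha Hc).
  set (q := quotient_coeff a c) in *.
  assert (Es : shift a = fun n => q n - c * shift q n).
  { apply functional_extensionality. intros n. unfold shift, q.
    rewrite (quotient_coeff_rec a M c n) by assumption. ring. }
  assert (Esum : CPSeries (shift a) w = CPSeries q w - c * CPSeries (shift q) w).
  { rewrite Es.
    apply CPSeries_minus_scal with (M / (1 - Cmod c))%R (M / (1 - Cmod c))%R;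
      [ | intros n; apply Hq | ]; assumption. }
  assert (Ew : w * CPSeries (shift q) w = CPSeries q w - q 0%nat).
  { rewrite (CPSeries_rec q (M / (1 - Cmod c))%R w) by assumption. ring. }
  rewrite (CPSeries_rec a M w), (CPSeries_quotient_0 a M c), Esum by assumption.
  fold q.
  replace (w * (CPSeries q w - c * CPSeries (shift q) w))
    with (w * CPSeries q w - c * (w * CPSeries (shift q) w)) by ring.
  rewrite Ew. ring.
Qed.

(** * Orders of vanishing *)

Lemma has_multiplicity_vanishes f z m n :
  has_multiplicity f z m -> (n <= m)%nat -> vanishes_to_order f z n.
Proof.
  intros (g & _ & Hd & Hf) Hnm.
  (* [g] is bounded near [z] because it is differentiable at [z]. *)
  assert (Hg : locally (T := AbsRing_UniformSpace C_AbsRing) z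
                 (fun w => Cmod (g w) < Cmod (g z) + 1)%R).
  { apply locally_singleton in Hd.
    apply (ex_derive_continuous (K := C_AbsRing) (V := C_NormedModule)) in Hd.
    assert (Hn := filterlim_comp _ _ _ _ _ _ _ _ Hd
                    (filterlim_norm (V := C_NormedModule) (g z))).
    specialize (Hn (fun r => r < Cmod (g z) + 1)%R). apply Hn.
    apply (open_lt (Cmod (g z) + 1)). change (Cmod (g z) < Cmod (g z) + 1)%R. lra. }
  apply locally_C in Hf.
  destruct Hg as [d1 Hd1], Hf as [d2 Hd2].
  exists (Cmod (g z) + 1)%R, (Rmin 1 (Rmin d1 d2)). split.
  { repeat apply Rmin_glb_lt; [lra | apply cond_pos | apply cond_pos]. }
  intros w [Hw0 Hw].
  assert (H1 : (Cmod (w - z) < 1)%R) by (eapply Rlt_le_trans; [exact Hw | apply Rmin_l]).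
  assert (Hr : (Cmod (w - z) < Rmin d1 d2)%R)
    by (eapply Rlt_le_trans; [exact Hw | apply Rmin_r]).
  rewrite Hd2 by (eapply Rlt_le_trans; [exact Hr | apply Rmin_r]).
  assert (Hgw : (Cmod (g w) < Cmod (g z) + 1)%R)
    by (apply Hd1; eapply Rlt_le_trans; [exact Hr | apply Rmin_l]).
  rewrite Cmod_mult, Cmod_pow, Rmult_comm.
  apply Rmult_le_compat;
    [apply Cmod_ge_0 | apply pow_le, Cmod_ge_0 | now apply Rlt_le | ].
  replace m with (n + (m - n))%nat by lia. rewrite pow_add.
  rewrite <- Rmult_1_r. apply Rmult_le_compat_l; [apply pow_le; lra | ].
  rewrite <- (pow1 (m - n)). apply pow_incr. lra.
Qed.

(** A power series is continuous in the disc, which is where the value at [z],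
    ignored by [vanishes_to_order], is recovered. *)
Lemma vanishes_CPSeries_root a M z n :
  coeff_bound a M -> (Cmod z < 1)%R ->
  vanishes_to_order (CPSeries a) z (S n) -> CPSeries a z = 0.
Proof.
  intros Ha Hz (K & d & Hd & HK).
  set (f := CPSeries a) in *.
  set (B := (M / (1 - Cmod z))%R).
  assert (HB : (0 <= B)%R).
  { apply (coeff_bound_nonneg (quotient_coeff a z)), quotient_coeff_bound; assumption. }
  set (L := (B / (1 - (1 + Cmod z) / 2))%R).
  assert (HL : (0 <= L)%R) by (apply Rcomplements.Rdiv_le_0_compat; lra).
  apply Cmod_eq_0. apply Rle_antisym; [ | apply Cmod_ge_0].
  apply Rnot_lt_le. intros Hpos.
  (* At the point [w = z + r], the order of vanishing gives [|f w| <= |K| r] and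
     the factorisation of [f w - f z] gives [|f w - f z| <= L r]; this [r] is
     small enough for the two to contradict [f z <> 0]. *)
  set (r := (Rmin (Rmin 1 (d / 2)) (Rmin ((1 - Cmod z) / 2)
                                            (Cmod (f z) / (2 * (Rabs K + L + 1)))))%R).
  assert (HS : (0 < 2 * (Rabs K + L + 1))%R) by (generalize (Rabs_pos K); lra).
  assert (Hr0 : (0 < r)%R).
  { unfold r. repeat apply Rmin_glb_lt; try lra. now apply Rdiv_lt_0_compat. }
  assert (Hr1 : (r <= 1)%R)
    by (unfold r; eapply Rle_trans; [apply Rmin_l | apply Rmin_l]).
  assert (Hr2 : (r <= d / 2)%R)
    by (unfold r; eapply Rle_trans; [apply Rmin_l | apply Rmin_r]).
  assert (Hr3 : (r <= (1 - Cmod z) / 2)%R)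
    by (unfold r; eapply Rle_trans; [apply Rmin_r | apply Rmin_l]).
  assert (Hr4 : (r <= Cmod (f z) / (2 * (Rabs K + L + 1)))%R)
    by (unfold r; eapply Rle_trans; [apply Rmin_r | apply Rmin_r]).
  set (w := z + RtoC r).
  assert (Ewz : Cmod (w - z) = r).
  { unfold w. replace (z + RtoC r - z) with (RtoC r) by ring.
    rewrite Cmod_R. apply Rabs_pos_eq. lra. }
  assert (Hw : (Cmod w <= (1 + Cmod z) / 2)%R).
  { unfold w. eapply Rle_trans; [apply Cmod_triangle | ].
    rewrite Cmod_R, Rabs_pos_eq; lra. }
  assert (Hfw : (Cmod (f w) <= Rabs K * r)%R).
  { eapply Rle_trans; [apply HK; rewrite Ewz; lra | ]. rewrite Ewz.
    assert (0 <= r ^ S n <= r)%R.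
    { split; [apply pow_le; lra | ]. simpl.
      assert (r ^ n <= 1)%R by (rewrite <- (pow1 n); apply pow_incr; lra). nra. }
    apply Rle_trans with (Rabs K * r ^ S n)%R.
    - apply Rmult_le_compat_r; [lra | apply Rle_abs].
    - apply Rmult_le_compat_l; [apply Rabs_pos | lra]. }
  assert (Hdiff : (Cmod (f w - f z) <= r * L)%R).
  { unfold f. rewrite (CPSeries_quotient a M z w) by (assumption || lra).
    rewrite Cmod_mult, Ewz. apply Rmult_le_compat_l; [lra | ].
    eapply Rle_trans.
    - apply Cmod_CPSeries_le; [now apply quotient_coeff_bound | lra].
    - fold B. unfold L, Rdiv at 1 2. apply Rmult_le_compat_l; [exact HB | ].
      apply Rinv_le_contravar; lra. }
  assert (Hz' : (Cmod (f z) <= Cmod (f w) + Cmod (f w - f z))%R).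
  { rewrite <- (Cmod_opp (f w - f z)).
    replace (f z) with (f w + - (f w - f z)) at 1 by ring. apply Cmod_triangle. }
  apply (Rmult_le_compat_r (2 * (Rabs K + L + 1))%R) in Hr4; [ | lra].
  unfold Rdiv in Hr4. rewrite Rmult_assoc, Rinv_l, Rmult_1_r in Hr4 by lra.
  nra.
Qed.

(** Since [|f w| = |w - c| |Q w|], a bound on [f] gives one on [Q]: at [z = c]
    exactly one power of [|w - z|] cancels, and elsewhere [|w - c|] stays away
    from [0] near [z]. *)
Lemma vanishes_to_order_quotient a M c z m n :
  coeff_bound a M -> (Cmod c < 1)%R -> (Cmod z < 1)%R -> CPSeries a c = 0 ->
  vanishes_to_order (CPSeries a) z m ->
  (z = c -> m = S n) -> (z <> c -> m = n) ->
  vanishes_to_order (CPSeries (quotient_coeff a c)) z n.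
Proof.
  intros Ha Hc Hz Hroot (K & d & Hd & HK) Heq Hneq.
  set (Q := CPSeries (quotient_coeff a c)).
  assert (Hfact : forall w, (Cmod (w - z) < 1 - Cmod z)%R ->
    Cmod (CPSeries a w) = (Cmod (w - c) * Cmod (Q w))%R).
  { intros w Hw. rewrite <- Cmod_mult. unfold Q.
    rewrite <- (CPSeries_quotient a M c w), Hroot; [f_equal; ring | assumption.. | ].
    replace w with (w - z + z) by ring.
    eapply Rle_lt_trans; [apply Cmod_triangle | lra]. }
  destruct (Ceq_dec z c) as [-> | Hzc].
  - rewrite (Heq eq_refl) in HK.
    exists K, (Rmin d (1 - Cmod c)). split; [apply Rmin_glb_lt; lra | ].
    intros w [Hw0 Hw].
    assert (Hwd := Rlt_le_trans _ _ _ Hw (Rmin_l _ _)).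
    assert (Hwc := Rlt_le_trans _ _ _ Hw (Rmin_r _ _)).
    apply Rmult_le_reg_l with (Cmod (w - c)); [exact Hw0 | ].
    rewrite <- Hfact by assumption.
    eapply Rle_trans; [now apply HK | right; simpl; ring].
  - rewrite (Hneq Hzc) in HK.
    set (e := Cmod (z - c)).
    assert (He : (0 < e)%R).
    { apply Cmod_gt_0. intros E. apply Hzc.
      replace z with (z - c + c) by ring. rewrite E. ring. }
    (* The radius [e / 2] keeps [w] at distance at least [e / 2] from [c]. *)
    exists (2 * K / e)%R, (Rmin (e / 2) (Rmin d (1 - Cmod z))). split.
    { repeat apply Rmin_glb_lt; lra. }
    intros w [Hw0 Hw].
    assert (Hwe := Rlt_le_trans _ _ _ Hw (Rmin_l _ _)).
    assert (Hw' := Rlt_le_trans _ _ _ Hw (Rmin_r _ _)).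
    assert (Hwd := Rlt_le_trans _ _ _ Hw' (Rmin_l _ _)).
    assert (Hwz := Rlt_le_trans _ _ _ Hw' (Rmin_r _ _)).
    assert (Hfar : (e / 2 <= Cmod (w - c))%R).
    { assert (e <= Cmod (w - c) + Cmod (w - z))%R; [ | lra].
      unfold e. rewrite <- (Cmod_opp (w - z)).
      replace (z - c) with (w - c + - (w - z)) by ring. apply Cmod_triangle. }
    assert (HKw := HK w (conj Hw0 Hwd)). rewrite Hfact in HKw by assumption.
    apply Rmult_le_reg_l with (e / 2)%R; [lra | ].
    apply Rle_trans with (Cmod (w - c) * Cmod (Q w))%R.
    + apply Rmult_le_compat_r; [apply Cmod_ge_0 | exact Hfar].
    + eapply Rle_trans; [exact HKw | right; field; lra].
Qed.

(** * The product over the roots *)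

(** Both products are kept in the inequality, without quotients, so that roots
    at the origin need no separate treatment. *)
Lemma constant_term_prod_roots_le ls : forall a M,
  coeff_bound a M ->
  (forall z, In z ls ->
     (Cmod z < 1)%R /\ vanishes_to_order (CPSeries a) z (count_occ Ceq_dec ls z)) ->
  (Cmod (a 0%nat) * prod_list (map (fun z : C => 1 - Cmod z)%R ls)
     <= M * prod_list (map Cmod ls))%R.
Proof.
  induction ls as [ | c t IH]; intros a M Ha Hls; cbn [map prod_list fold_right].
  { rewrite !Rmult_1_r. apply Ha. }
  destruct (Hls c (or_introl eq_refl)) as [Hc Hvc].
  assert (Hroot : CPSeries a c = 0).
  { apply (vanishes_CPSeries_root a M c (count_occ Ceq_dec t c)); [assumption.. | ].
    rewrite count_occ_cons_eq in Hvc by reflexivity. exact Hvc. }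
  assert (Hq := IH (quotient_coeff a c) (M / (1 - Cmod c))%R
                  (quotient_coeff_bound a M c Ha Hc)).
  assert (Ha0 : Cmod (a 0%nat) = (Cmod c * Cmod (quotient_coeff a c 0))%R).
  { rewrite <- Cmod_mult, <- Cmod_opp. f_equal.
    rewrite (CPSeries_quotient_0 a M c Ha Hc) in Hroot.
    replace (c * quotient_coeff a c 0)
      with (a 0%nat + c * quotient_coeff a c 0 - a 0%nat) by ring.
    rewrite Hroot. ring. }
  rewrite Ha0. fold (prod_list (map (fun z : C => 1 - Cmod z)%R t)) (prod_list (map Cmod t)).
  set (A := prod_list (map (fun z : C => 1 - Cmod z)%R t)) in *.
  set (B := prod_list (map Cmod t)) in *.
  replace (Cmod c * Cmod (quotient_coeff a c 0) * ((1 - Cmod c) * A))%R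
    with (Cmod c * (1 - Cmod c) * (Cmod (quotient_coeff a c 0) * A))%R by ring.
  replace (M * (Cmod c * B))%R
    with (Cmod c * (1 - Cmod c) * (M / (1 - Cmod c) * B))%R by (field; lra).
  apply Rmult_le_compat_l.
  { apply Rmult_le_pos; [apply Cmod_ge_0 | lra]. }
  apply Hq. intros z Hz.
  destruct (Hls z (or_intror Hz)) as [Hz1 Hv]. split; [exact Hz1 | ].
  apply (vanishes_to_order_quotient a M c z (count_occ Ceq_dec (c :: t) z));
    [assumption.. | | ]; intros E.
  - now apply count_occ_cons_eq.
  - apply count_occ_cons_neq. now apply not_eq_sym.
Qed.

Lemma prod_inv_sub_1 (ls : list C) :
  (forall z, In z ls -> z <> 0) ->
  (0 < prod_list (map Cmod ls))%R /\
  (prod_list (map (fun z : C => / Cmod z - 1)%R ls) * prod_list (map Cmod ls)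
    = prod_list (map (fun z : C => 1 - Cmod z)%R ls))%R.
Proof.
  unfold prod_list.
  induction ls as [ | c t IH]; intros H; cbn [map fold_right]; [split; lra | ].
  destruct IH as [Hpos E]; [intros z Hz; apply H; now right | ].
  assert (Hc : (0 < Cmod c)%R) by (apply Cmod_gt_0, H; now left).
  split; [now apply Rmult_lt_0_compat | ].
  rewrite <- E. field. lra.
Qed.

Lemma root_neq_0 p M z :
  coeff_bound p M -> p 0%nat = 1 -> (Cmod z < 1)%R -> CPSeries p z = 0 -> z <> 0.
Proof.
  intros Hp p0 Hz H0 ->. rewrite (CPSeries_rec p M 0 Hp Hz), p0 in H0.
  apply C1_nz. rewrite <- H0. ring.
Qed.

Lemma prod_roots_le p M ls :
  coeff_bound p M -> p 0%nat = 1 ->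
  disc_roots_with_multiplicity (CPSeries p) ls ->
  (prod_list (map (fun z : C => / Cmod z - 1)%R ls) <= M)%R.
Proof.
  intros Hp p0 Hls.
  destruct (prod_inv_sub_1 ls) as [Hpos E].
  { intros z Hz. destruct (Hls z Hz) as (H1 & H0 & _). now apply (root_neq_0 p M). }
  apply Rmult_le_reg_r with (prod_list (map Cmod ls)); [exact Hpos | ].
  rewrite E, <- (Rmult_1_l (prod_list (map (fun z : C => 1 - Cmod z)%R ls))).
  rewrite <- Cmod_1 at 1. rewrite <- p0. apply constant_term_prod_roots_le; [exact Hp | ].
  intros z Hz. destruct (Hls z Hz) as (H1 & _ & m & Hm & Hcount).
  split; [exact H1 | ]. now apply has_multiplicity_vanishes with m.
Qed.

(** Boundedness matters here: it makes the extended supremum finite, so that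
    taking its real part loses nothing. *)
Lemma coeff_bound_sup p B : coeff_bound p B -> coeff_bound p (sup_coeff p).
Proof.
  intros HB j. unfold sup_coeff.
  assert (Hup : Rbar_le (Sup_seq (fun j => Finite (Cmod (p j)))) B).
  { apply Rbar_not_lt_le. intros H. apply Sup_seq_minor_lt in H.
    destruct H as [n Hn]. specialize (HB n). simpl in Hn. lra. }
  assert (Hlow : Rbar_le (Cmod (p j)) (Sup_seq (fun j => Finite (Cmod (p j))))).
  { apply (Sup_seq_minor_le _ _ j). apply Rbar_le_refl. }
  destruct (Sup_seq (fun j => Finite (Cmod (p j)))); simpl in *; tauto.
Qed.

Lemma pow_lt_prod_list x rs :
  (0 < x)%R -> rs <> nil -> (forall r, In r rs -> (x < r)%R) ->
  (x ^ length rs < prod_list rs)%R.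
Proof.
  intros Hx Hne Hr. unfold prod_list.
  induction rs as [ | r t IH]; [contradiction | clear Hne].
  assert (Hxr : (x < r)%R) by (apply Hr; now left).
  destruct t as [ | r' t]; [simpl; lra | ].
  cbn [length pow fold_right] in *.
  apply Rmult_gt_0_lt_compat; [ | lra | exact Hxr | ].
  - apply Rmult_lt_0_compat; [exact Hx | now apply pow_lt].
  - apply IH; [discriminate | intros s Hs; apply Hr; now right].
Qed.

Theorem theorem4p1 (S : C -> Prop) (p : nat -> C)
    (S_nonempty : exists s : C, S s)
    (S_bounded : exists B : R, forall s : C, S s -> (Cmod s <= B)%R)
    (p_in_S : forall j : nat, S (p j))
    (p0 : p 0%nat = RtoC 1) :
  (forall ls : list C,
     disc_roots_with_multiplicity (CPSeries p) ls ->
     (prod_list (map (fun z => / Cmod z - 1) ls) <= sup_coeff p)%R) /\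
  (forall k : nat, (1 <= k)%nat ->
     ~ exists ls : list C,
         length ls = k /\
         disc_roots_with_multiplicity (CPSeries p) ls /\
         (forall z : C, In z ls ->
            (Cmod z < 1 / (Rpower (sup_coeff p) (1 / INR k) + 1))%R)).
Proof.
  assert (Hp : coeff_bound p (sup_coeff p)).
  { destruct S_bounded as [B HB]. apply coeff_bound_sup with B.
    intros j. apply HB, p_in_S. }
  split; [intros ls; now apply prod_roots_le | ].
  intros k Hk (ls & Hlen & Hls & Hsmall).
  apply (Rle_not_lt _ _ (prod_roots_le p _ ls Hp p0 Hls)).
  set (M := sup_coeff p) in *.
  set (x := Rpower M (1 / INR k)) in *.
  assert (HM : (0 < M)%R).
  { specialize (Hp 0%nat). rewrite p0, Cmod_1 in Hp. lra. }
  assert (Hx : (0 < x)%R) by apply exp_pos.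
  assert (Hxk : (x ^ k = M)%R).
  { rewrite <- Rpower_pow by exact Hx. unfold x. rewrite Rpower_mult.
    replace (1 / INR k * INR k)%R with 1%R; [now apply Rpower_1 | ].
    field. apply not_0_INR. lia. }
  rewrite <- Hxk at 1.
  rewrite <- Hlen, <- (length_map (fun z => (/ Cmod z - 1)%R) ls).
  apply pow_lt_prod_list; [exact Hx | | ].
  - intros E. apply map_eq_nil in E. subst ls. simpl in Hlen. lia.
  - intros r Hr. apply in_map_iff in Hr. destruct Hr as (z & <- & Hz).
    assert (Hz0 : (0 < Cmod z)%R).
    { destruct (Hls z Hz) as (H1 & H0 & _). apply Cmod_gt_0. now apply (root_neq_0 p M). }
    specialize (Hsmall z Hz).
    apply Rinv_lt_contravar in Hsmall.
    + unfold Rdiv in Hsmall. rewrite Rmult_1_l, Rinv_inv in Hsmall. lra.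
    + apply Rmult_lt_0_compat; [exact Hz0 | ]. apply Rdiv_lt_0_compat; lra.
Qed.
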